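(* For every $\delta \in (0,1)$ and every $\gamma > 0$, there exists a finite universe $\Omega$ and a family $\mathcal{F}$ of pairs $(P,Q)$ of probability distributions on $\Omega$, each satisfying $d_{\mathrm{TV}}(P,Q) \le \delta$, such that every correlated sampling strategy $(f,g)$ on $\Omega$ has error at least $\frac{2\delta}{1+\delta} - \gamma$ on this family, i.e. there exists $(P,Q) \in \mathcal{F}$ with $\Pr_{r \sim \mathcal{R}}[f(P,r) \neq g(Q,r)] \ge \frac{2\delta}{1+\delta} - \gamma$.
   Context: Let $\Omega$ be a finite universe and $\Delta_\Omega$ the set of probability distributions on $\Omega$. The total variation distance is $d_{\mathrm{TV}}(P,Q) = \frac12 \sum_{\omega \in \Omega} |P(\omega) - Q(\omega)|$. A correlated sampling strategy consists of a probability space $\mathcal{R}$ of shared randomness (of arbitrary size) and functions $f, g : \Delta_\Omega \times \mathcal{R} \to \Omega$ such that for every $P, Q \in \Delta_\Omega$, when $r \sim \mathcal{R}$ the random variable $f(P,r)$ has distribution exactly $P$ and $g(Q,r)$ has distribution exactly $Q$. Its disagreement probability on a pair $(P,Q)$ is $\Pr_{r \sim \mathcal{R}}[f(P,r) \neq g(Q,r)]$. *)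

(* Defs.v *)
From HB Require Import structures.
From mathcomp Require Export all_boot all_order all_algebra.
From mathcomp Require Export all_classical all_reals all_analysis.

Set Implicit Arguments.
Unset Strict Implicit.
Unset Printing Implicit Defensive.

Import Order.TTheory GRing.Theory Num.Theory.

Local Open Scope classical_set_scope.
Local Open Scope ring_scope.

Record fdist (R : realType) (Omega : finType) := FDist {
  fdist_mass :> {ffun Omega -> R};
  fdist_ge0 : forall w, 0 <= fdist_mass w;
  fdist_sum1 : \sum_(w : Omega) fdist_mass w = 1 }.

Definition dTV (R : realType) (Omega : finType) (P Q : fdist R Omega) : R :=
  2^-1 * \sum_(w : Omega) `|P w - Q w|.

(* A finType carries no canonical measurable structure; the first conjunct is
   measurability of X for the discrete sigma-algebra on Omega. *)
Definition has_law (R : realType) (Omega : finType) (d : measure_display)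
    (T : measurableType d) (Pr : probability T R) (X : T -> Omega)
    (P : fdist R Omega) : Prop :=
  (forall A : set Omega, measurable (X @^-1` A)) /\
  (forall w : Omega, Pr [set r | X r = w] = (P w)%:E).

Definition correlated_sampling_strategy (R : realType) (Omega : finType)
    (d : measure_display) (T : measurableType d) (Pr : probability T R)
    (f g : fdist R Omega -> T -> Omega) : Prop :=
  (forall P : fdist R Omega, has_law Pr (f P) P) /\
  (forall Q : fdist R Omega, has_law Pr (g Q) Q).

Definition disagreement (R : realType) (Omega : finType)
    (d : measure_display) (T : measurableType d) (Pr : probability T R)
    (f g : fdist R Omega -> T -> Omega) (P Q : fdist R Omega) : \bar R :=
  Pr [set r | f P r <> g Q r].

(* Main.v *)
Require Import Defs.
From mathcomp Require Import all_boot all_order all_algebra.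
From mathcomp Require Import all_classical all_reals all_analysis.
From mathcomp Require Import measurable_realfun.
From mathcomp Require Import ring lra zify.

(** Let [p] be slightly above [1 - delta].  On the grid ['I_n * 'I_n] take for [P]
    the uniform distributions on unions of [k = p n] rows and for [Q] those on
    unions of [k] columns; any such [P] and [Q] are at distance exactly [1 - k / n].
    Draw the rows and the columns independently and uniformly.  For a fixed value
    of the shared randomness let [F x] be the probability that [f P] is the cell
    [x].  A set [X] of cells meets a random union of rows with probability at most
    about [1 - (1 - p) ^ #|X|], so that [F] is majorized by the geometric
    distribution [p (1 - p) ^ i] and [\sum_x F x ^ 2 <= p / (2 - p)]; the same holds
    for [G] defined from [g Q].  By AM-GM the probability [\sum_x F x * G x] of
    agreement is at most [p / (2 - p)], close to [(1 - delta) / (1 + delta)], and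
    averaging over the shared randomness yields a pair with at most this
    probability of agreement. *)

Import Order.TTheory GRing.Theory Num.Theory.

Local Open Scope ring_scope.

(** * Majorization and sums of squares *)

(** Abel summation in inductive form: the partial sums of [w] being nonnegative, a smaller factor in
    front of them only decreases the product. *)
Lemma le_sum_mulr_nonincreasing (R : realDomainType) (a w : nat -> R) (N : nat) :
  (forall i, a i.+1 <= a i) -> (forall j, 0 <= \sum_(i < j) w i) ->
  a N * \sum_(i < N) w i <= \sum_(i < N) a i * w i.
Proof.
move=> a_dec w_ge0; elim: N => [|N IHN]; first by rewrite !big_ord0 mulr0.
apply: (@le_trans _ _ (a N * \sum_(i < N.+1) w i)).
  exact: ler_wpM2r.
by rewrite !big_ord_recr /= mulrDr lerD2r.
Qed.

(** With [a] the decreasing rearrangement of [F], the partial sums of [d - a] are nonnegative. Abel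
    summation against [a] and against [d] gives two nonnegative sums, which add up to the sum of
    [(d + a) * (d - a) = d ^ 2 - a ^ 2]. *)
Lemma sum_sqr_majorized (R : realDomainType) (I : finType) (F : I -> R)
    (d : nat -> R) :
  (forall x, 0 <= F x) -> (forall i, 0 <= d i) -> (forall i, d i.+1 <= d i) ->
  (forall X : {set I}, \sum_(x in X) F x <= \sum_(i < #|X|) d i) ->
  \sum_x F x ^+ 2 <= \sum_(i < #|I|) d i ^+ 2.
Proof.
move=> F_ge0 d_ge0 d_dec F_le.
pose r : rel I := fun x y => F y <= F x.
pose s := sort r (enum I).
have s_perm : perm_eq s (enum I) by rewrite /s perm_sort.
have s_size : size s = #|I| by rewrite (perm_size s_perm) cardE.
have s_uniq : uniq s by rewrite (perm_uniq s_perm) enum_uniq.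
(* The default 0 keeps [a] nonnegative and nonincreasing past the end of the list. *)
pose a i := nth 0 (map F s) i.
have a_ge0 i : 0 <= a i.
  rewrite /a; have [lt_is|le_si] := ltnP i (size (map F s)); last by rewrite nth_default.
  by have /mapP[x _ ->] := mem_nth 0 lt_is.
have a_dec i : a i.+1 <= a i.
  have [lt_is|le_si] := ltnP i.+1 (size (map F s)); last by rewrite /a nth_default.
  have : sorted >=%O (map F s).
    by rewrite sorted_map; apply: sort_sorted => x y; exact: le_total.
  by move/(sortedP 0)/(_ _ lt_is).
have sum_take j : \sum_(i < j) a i = \sum_(x in [set x in take j s]%SET) F x.
  rewrite -(big_mkord xpredT a).
  have -> : \sum_(0 <= i < j) a i = \sum_(x <- take j s) F x.
    rewrite -(big_map F xpredT id) map_take.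
    elim: j => [|j IHj]; first by rewrite big_geq // take0 big_nil.
    rewrite big_nat_recr //= IHj.
    have [lt_js|le_sj] := ltnP j (size (map F s)).
      by rewrite (take_nth 0) // -cats1 big_cat big_seq1.
    by rewrite /a nth_default // addr0 !take_oversize // ltnW.
  rewrite -big_enum /=; apply: perm_big; apply: uniq_perm.
  - exact: take_uniq.
  - exact: enum_uniq.
  - by move=> x; rewrite mem_enum inE.
have w_ge0 j : 0 <= \sum_(i < j) (d i - a i).
  rewrite sumrB subr_ge0 sum_take (le_trans (F_le _)) //.
  (* The inequality is strict once [j] exceeds [#|I|]; the surplus terms of [d] are nonnegative. *)
  have le_j : (#|[set x in take j s]%SET| <= j)%N.
    rewrite cardsE; apply: (leq_trans (card_size _)).
    by rewrite size_take_min geq_minl.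
  rewrite -(big_mkord xpredT d) -[leRHS](big_mkord xpredT d).
  rewrite [leRHS](big_cat_nat _ (n := #|[set x in take j s]%SET|)) //=.
  by rewrite lerDl sumr_ge0.
have -> : \sum_x F x ^+ 2 = \sum_(i < #|I|) a i ^+ 2.
  rewrite -big_enum /= -(perm_big _ s_perm) /= -(big_map F xpredT (fun y => y ^+ 2)).
  by rewrite (big_nth 0) size_map s_size big_mkord.
have a_le := le_trans (mulr_ge0 (a_ge0 #|I|) (w_ge0 #|I|))
  (le_sum_mulr_nonincreasing _ a (fun i => d i - a i) #|I| a_dec w_ge0).
have d_le := le_trans (mulr_ge0 (d_ge0 #|I|) (w_ge0 #|I|))
  (le_sum_mulr_nonincreasing _ d (fun i => d i - a i) #|I| d_dec w_ge0).
rewrite -subr_ge0 -sumrB; apply: le_trans (addr_ge0 a_le d_le) _.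
by rewrite -big_split /=; apply: ler_sum => i _; lra.
Qed.

(** * Counting agreements for a fixed value of the randomness *)

(** Each [j] is counted for at most one [x], namely [f j], and then [A j] meets [X] at that
    point. *)
Lemma card_hit_bound (J I : finType) (A : J -> {set I}) (f : J -> I)
    (X : {set I}) :
  (\sum_(x in X) #|[pred j | (f j == x) && (x \in A j)]| <=
   #|[set j | ~~ [disjoint A j & X]]%SET|)%N.
Proof.
under eq_bigr do rewrite -sum1_card.
rewrite -sum1_card.
rewrite (exchange_big_dep [pred j | ~~ [disjoint A j & X]]) /=; last first.
  move=> x j xX /andP[_ xA]; apply/negP => /pred0P/(_ x) /=.
  by rewrite xX xA.
under [leqRHS]eq_bigl do rewrite inE.
apply: leq_sum => j _.
rewrite sum1_card -(card1 (f j)); apply/subset_leq_card/fintype.subsetP => x.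
by rewrite !inE => /and3P[_ /eqP->].
Qed.

(** The two components of a pair vary independently, so exactly [F x * G x] pairs agree at [x]; then
    [2 * F x * G x <= F x ^ 2 + G x ^ 2] reduces the count to two majorized sums of squares. *)
Lemma card_agreement_le (R : realDomainType) (J I : finType)
    (A B : J -> {set I}) (f g : J -> I) (d : nat -> R) :
  (forall i, 0 <= d i) -> (forall i, d i.+1 <= d i) ->
  (forall X : {set I},
    #|[set j | ~~ [disjoint A j & X]]%SET|%:R <= \sum_(i < #|X|) d i) ->
  (forall X : {set I},
    #|[set j | ~~ [disjoint B j & X]]%SET|%:R <= \sum_(i < #|X|) d i) ->
  #|[set p : J * J | [&& f p.1 == g p.2, f p.1 \in A p.1 & g p.2 \in B p.2]]%SET|%:R
    <= \sum_(i < #|I|) d i ^+ 2.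
Proof.
move=> d_ge0 d_dec hitA hitB.
pose F x : nat := #|[pred j | (f j == x) && (x \in A j)]|.
pose G x : nat := #|[pred j | (g j == x) && (x \in B j)]|.
have sqF : \sum_x (F x)%:R ^+ 2 <= \sum_(i < #|I|) d i ^+ 2.
  apply: sum_sqr_majorized => // X; rewrite -natr_sum; apply: le_trans (hitA X).
  by rewrite ler_nat card_hit_bound.
have sqG : \sum_x (G x)%:R ^+ 2 <= \sum_(i < #|I|) d i ^+ 2.
  apply: sum_sqr_majorized => // X; rewrite -natr_sum; apply: le_trans (hitB X).
  by rewrite ler_nat card_hit_bound.
have -> : #|[set p : J * J | [&& f p.1 == g p.2, f p.1 \in A p.1 & g p.2 \in B p.2]]%SET|
    = (\sum_x F x * G x)%N.
  rewrite -sum1_card (partition_big (fun p : J * J => f p.1) xpredT) //=.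
  apply: eq_bigr => x _; rewrite /F /G -cardX -sum1_card; apply: eq_bigl => -[i j].
  rewrite !inE /=; case: (eqVneq (f i) x) => [->|]; last by rewrite andbF.
  by rewrite andbT /= andbCA eq_sym; case: (eqVneq (g j) x) => [->|] //=; rewrite ?andbF.
rewrite natr_sum -(@ler_pM2l _ 2) // mulr_sumr.
apply: (@le_trans _ _ (\sum_x (F x)%:R ^+ 2 + \sum_x (G x)%:R ^+ 2)); last by lra.
rewrite -big_split; apply: ler_sum => x _ /=.
by rewrite natrM; have := sqr_ge0 ((F x)%:R - (G x)%:R : R); rewrite sqrrB; lra.
Qed.

(** * Hitting probabilities of a random draw *)

(** Passing from [j] to [j.+1] multiplies the binomial by [(N - j - K) / (N - j)], which is at most
    [(N - K) / N]. *)
Lemma bin_geometric_le (R : realFieldType) (N K j : nat) : (K <= N)%N -> (j <= N)%N ->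
  'C(N - j, K)%:R <= 'C(N, K)%:R * ((N - K)%:R / N%:R) ^+ j :> R.
Proof.
move=> le_KN; elim: j => [|j IHj] lt_jN; first by rewrite subn0 mulr1.
have N_gt0 : 0 < N%:R :> R by rewrite ltr0n; lia.
have Nj_gt0 : 0 < (N - j)%:R :> R by rewrite ltr0n; lia.
have rec : 'C(N - j.+1, K)%:R = (N - j - K)%:R / (N - j)%:R * 'C(N - j, K)%:R :> R.
  apply: (mulfI (lt0r_neq0 Nj_gt0)); rewrite -natrM subnS mul_bin_down natrM.
  by field; exact: lt0r_neq0.
rewrite rec exprS mulrCA; apply: ler_pM => //; last exact: IHj (ltnW lt_jN).
rewrite ler_pdivrMr // mulrAC ler_pdivlMr // -!natrM ler_nat; nia.
Qed.

(** By Pascal's rule the left side telescopes into the ['C(N - i, K)] with [i < x]: these count the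
    draws that contain point [i] but none of the points before it. *)
Lemma bin_sub_geometric_le (R : realFieldType) (N K x : nat) :
  (K <= N)%N -> (x <= N.+1)%N ->
  'C(N.+1, K.+1)%:R - 'C(N.+1 - x, K.+1)%:R
    <= \sum_(i < x) 'C(N, K)%:R * ((N - K)%:R / N%:R) ^+ i :> R.
Proof.
move=> le_KN; elim: x => [|x IHx] lt_xN; first by rewrite subn0 subrr big_ord0.
rewrite big_ord_recr /=.
have := IHx (ltnW lt_xN); have := @bin_geometric_le R N K x le_KN lt_xN.
have -> : (N.+1 - x = (N - x).+1)%N by lia.
rewrite subSS (binS (N - x)) natrD.
move: (\sum_(i < x) _) (_ * _) => S T; lra.
Qed.

Lemma card_draws_sig (T : finType) (k : nat) :
  #|{: {S : {set T} | #|S| == k}}| = 'C(#|T|, k).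
Proof. by rewrite card_sig -card_draws cardsE. Qed.

(* How [X] is spread over the fibres of [pr] is irrelevant, as [pr @: X] has at
   most [#|X|] elements: this lets cells of the grid be counted like rows. *)
Lemma card_draws_hit_le (R : realFieldType) (I : finType) (N K : nat)
    (pr : I -> 'I_N.+1) (X : {set I}) : (K <= N)%N ->
  #|[set S : {S : {set 'I_N.+1} | #|S| == K.+1} |
      ~~ [disjoint pr @^-1: (val S) & X]]%SET|%:R
    <= \sum_(i < #|X|) 'C(N, K)%:R * ((N - K)%:R / N%:R) ^+ i :> R.
Proof.
move=> le_KN; pose J := {S : {set 'I_N.+1} | #|S| == K.+1}; set D := [set S : J | _]%SET.
set x := #|pr @: X|.
have le_xN : (x <= N.+1)%N by rewrite -[leqRHS]card_ord max_card.
have le_xX : (x <= #|X|)%N by exact: leq_imset_card.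
(* The draws that miss [X] are the [K.+1]-subsets of the complement of [pr @: X]. *)
have card_miss : #|~: D| = 'C(N.+1 - x, K.+1).
  have -> : (N.+1 - x = #|~: (pr @: X)|)%N 
    by have := cardsC (pr @: X); rewrite card_ord -/x; lia.
  rewrite -cards_draws -(card_imset _ val_inj); apply: eq_card => S.
  rewrite !inE; apply/imsetP/andP => [[T + ->]|[dis cardS]].
    rewrite !inE negbK => dis; split; last exact: (valP T).
    apply/fintype.subsetP => i + /[!inE]; apply: contraL => /imsetP[y yX ->].
    apply/negP => prT.
    by have /pred0P/(_ y) /= := dis; rewrite inE prT yX.
  exists (exist _ S cardS) => //; rewrite !inE negbK /=.
  apply/pred0P => y /=; rewrite inE; apply/negP => /andP[prS yX].
  by have := fintype.subsetP dis _ prS; rewrite inE imset_f.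
have cardJ : #|{: J}| = 'C(N.+1, K.+1).
  by rewrite card_draws_sig card_ord.
have -> : #|D|%:R = 'C(N.+1, K.+1)%:R - 'C(N.+1 - x, K.+1)%:R :> R.
  by rewrite -card_miss -cardJ -(cardsC D) natrD addrK.
apply: (le_trans (@bin_sub_geometric_le R N K x le_KN le_xN)).
rewrite -[leLHS](big_mkord xpredT (fun i => 'C(N, K)%:R * ((N - K)%:R / N%:R) ^+ i)).
rewrite -[leRHS](big_mkord xpredT (fun i => 'C(N, K)%:R * ((N - K)%:R / N%:R) ^+ i)).
rewrite [leRHS](big_cat_nat _ (n := x)) //=.
by rewrite lerDl sumr_ge0.
Qed.

Lemma sum_sqr_geometric_le (R : realFieldType) (c q : R) (m : nat) :
  0 <= q -> q < 1 ->
  \sum_(i < m) (c * q ^+ i) ^+ 2 <= c ^+ 2 / (1 - q ^+ 2).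
Proof.
move=> q_ge0 q_lt1.
have q2_lt1 : 0 < 1 - q ^+ 2 by rewrite subr_gt0 expr_lt1.
rewrite ler_pdivlMr //.
under eq_bigr do rewrite exprMn exprAC.
rewrite -mulr_sumr -mulrA ler_piMr ?sqr_ge0 // mulrC.
have := subrX1 (q ^+ 2) m; have : 0 <= (q ^+ 2) ^+ m by rewrite !exprn_ge0.
by move: (\sum_(i < m) _) => S; lra.
Qed.

(** * Uniform distributions *)

Lemma uniform_ge0 (R : realType) (I : finType) (A : {set I}) (x : I) :
  0 <= [ffun x => (x \in A)%:R / #|A|%:R : R] x.
Proof. by rewrite ffunE divr_ge0. Qed.

Lemma uniform_sum1 (R : realType) (I : finType) (A : {set I}) :
  (0 < #|A|)%N -> \sum_x [ffun x => (x \in A)%:R / #|A|%:R : R] x = 1.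
Proof.
move=> A_gt0; under eq_bigr do rewrite ffunE.
by rewrite -mulr_suml -natr_sum -big_mkcond sum1_card divff // pnatr_eq0 -lt0n.
Qed.

Definition uniform_fdist (R : realType) (I : finType) (A : {set I})
    (A_gt0 : (0 < #|A|)%N) : fdist R I :=
  @FDist R I _ (@uniform_ge0 R I A) (@uniform_sum1 R I A A_gt0).

Lemma dTV_uniform (R : realType) (I : finType) (A B : {set I})
    (A_gt0 : (0 < #|A|)%N) (B_gt0 : (0 < #|B|)%N) : #|A| = #|B| ->
  dTV (uniform_fdist R I A A_gt0) (uniform_fdist R I B B_gt0) =
  1 - #|A :&: B|%:R / #|A|%:R.
Proof.
move=> AB; have A_neq0 : #|A|%:R != 0 :> R by rewrite pnatr_eq0 -lt0n.
have sum_mem (C : {set I}) : \sum_x (x \in C)%:R = #|C|%:R :> R.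
  by rewrite -natr_sum -big_mkcond sum1_card.
rewrite /dTV /=.
(* With equal denominators, the absolute difference is the scaled indicator of the symmetric
   difference. *)
have -> : \sum_w `|[ffun x => (x \in A)%:R / #|A|%:R : R] w
      - [ffun x => (x \in B)%:R / #|B|%:R : R] w| =
    \sum_w ((w \in A)%:R + (w \in B)%:R - 2 * (w \in A :&: B)%:R) / #|A|%:R.
  apply: eq_bigr => x _; rewrite !ffunE -AB -mulrBl normrM normfV normr_nat.
  congr (_ / _); rewrite inE; case: (x \in A); case: (x \in B) => /=;
    rewrite ?subrr ?subr0 ?sub0r ?normrN ?normr0 ?normr1; ring.
rewrite -mulr_suml sumrB big_split /= -mulr_sumr !sum_mem -AB.
by field.
Qed.

(** * Averaging over the shared randomness, and null events *)

Local Open Scope classical_set_scope.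

(** Integrating the pointwise bound shows that the mean of [Pr (E j)] over [j] is at most [theta],
    so the values cannot all exceed [theta]. *)
Lemma exists_probability_le (R : realType) (d : measure_display)
    (T : measurableType d) (Pr : probability T R) (J : finType)
    (E : J -> set T) (theta : R) :
  (0 < #|J|)%N -> (forall j, measurable (E j)) ->
  (forall r, \sum_j \1_(E j) r <= theta * #|J|%:R) ->
  exists j, (Pr (E j) <= theta%:E)%E.
Proof.
move=> J_gt0 mE sumE; apply: contrapT => /forallNP PrE.
have indic_ge0 (j : J) r : (0 <= (\1_(E j) r : R)%:E)%E by rewrite lee_fin.
have mindic (j : J) : measurable_fun setT (EFin \o (\1_(E j) : T -> R)).
  by apply/measurable_EFinP; exact: measurable_indic.
have := @ge0_le_integral _ _ _ Pr _ measurableT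
  (fun r => \sum_j (\1_(E j) r)%:E)%E (cst (theta * #|J|%:R)%:E).
rewrite (integral_cst Pr measurableT) [X in (_ * X)%E]probability_setT mule1.
rewrite (ge0_integral_sum Pr measurableT mindic); last by move=> j r _; exact: indic_ge0.
under eq_bigr do rewrite integral_indic // setIT.
have sum_gt : ((theta * #|J|%:R)%:E < \sum_j Pr (E j))%E.
  have Prfin j : Pr (E j) = (fine (Pr (E j)))%:E.
    by rewrite fineK // fin_num_measure.
  rewrite (eq_bigr _ (fun j _ => Prfin j)) sumEFin lte_fin.
  have -> : theta * #|J|%:R = \sum_(j : J) theta.
    by rewrite sumr_const mulr_natr.
  have [j0 _] : exists j0 : J, j0 \in J by apply/card_gt0P.
  apply: ltr_sum; first by apply/hasP; exists j0; rewrite ?mem_index_enum.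
  move=> j _.
  by move/negP: (PrE j); rewrite -ltNge Prfin lte_fin.
move=> le_int; have := le_int.
(* The conclusion of [le_int] contradicts [sum_gt]; its premises remain to be checked. *)
rewrite leNgt sum_gt => H; apply: notF; apply: H.
- by move=> r _; apply: sume_ge0.
- exact: emeasurable_sum.
- exact: measurable_cst.
- by move=> r _; rewrite sumEFin lee_fin; exact: sumE.
Qed.

Lemma measurable_finite_rel (I : finType) (d : measure_display)
    (T : measurableType d) (X Y : T -> I) (D : I -> I -> bool) :
  (forall A : set I, measurable (X @^-1` A)) ->
  (forall A : set I, measurable (Y @^-1` A)) ->
  measurable [set r | D (X r) (Y r)].
Proof.
move=> mX mY.
have -> : [set r | D (X r) (Y r)] =
    \bigcup_(w in [set: I]) (X @^-1` [set w] `&` Y @^-1` [set v | D w v]).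
  apply/seteqP; split=> [r Dr|r [w _ [/= -> //]]].
  by exists (X r).
apply: fin_bigcup_measurable; first exact: finite_finset.
by move=> w _; exact: measurableI.
Qed.

Lemma has_law_null (R : realType) (I : finType) (d : measure_display)
    (T : measurableType d) (Pr : probability T R) (X : T -> I) (P : fdist R I)
    (A : {set I}) :
  has_law Pr X P -> (forall w, w \notin A -> P w = 0) ->
  Pr [set r | X r \notin A] = 0%E.
Proof.
move=> [mX lawX] P0.
have -> : [set r | X r \notin A] =
    \big[setU/set0]_(w <- index_enum I | w \notin A) X @^-1` [set w].
  rewrite -bigcup_seq_cond; apply/seteqP; split=> [r /= Xr|r [w /= /andP[_ wA] ->//]].
  by exists (X r) => //=; rewrite mem_index_enum.
pose null S := measurable S /\ Pr S = 0%E.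
suff [] : null (\big[setU/set0]_(w <- index_enum I | w \notin A) X @^-1` [set w]) by [].
apply: (big_ind null) => [|S1 S2 [mS1 S10] [mS2 S20]|w wA].
- by split; [exact: measurable0|exact: measure0].
- by split; [exact: measurableU|rewrite measureU0].
- by split=> //; rewrite [LHS](lawX w) P0.
Qed.

(** A strategy respects the supports only almost surely, whereas the counting is done for every [r].
    Hence agreement is restricted to values in [A] and [B], at the cost of two null events. *)
Lemma disagreement_ge_supports (R : realType) (I : finType) (d : measure_display)
    (T : measurableType d) (Pr : probability T R) (X Y : T -> I)
    (P Q : fdist R I) (A B : {set I}) :
  has_law Pr X P -> has_law Pr Y Q ->
  (forall w, w \notin A -> P w = 0) -> (forall w, w \notin B -> Q w = 0) ->
  (1 - Pr [set r | [&& X r == Y r, X r \in A & Y r \in B]]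
    <= Pr [set r | X r <> Y r])%E.
Proof.
move=> lawX lawY P0 Q0; have [mX _] := lawX; have [mY _] := lawY.
set E := [set r | [&& _, _ & _]].
have mE : measurable E.
  exact: (measurable_finite_rel I _ _ _ _ (fun v w => [&& v == w, v \in A & w \in B])).
have mXA : measurable [set r | X r \notin A] by exact: (mX [set w | w \notin A]).
have mYB : measurable [set r | Y r \notin B] by exact: (mY [set w | w \notin B]).
have mD : measurable [set r | X r <> Y r].
  rewrite (_ : [set r | _] = [set r | X r != Y r]).
    exact: (measurable_finite_rel I _ _ _ _ (fun v w => v != w)).
  by apply/seteqP; split=> r /= /eqP.
rewrite -probability_setC //.
have -> : Pr [set r | X r <> Y r] =
    Pr ([set r | X r <> Y r] `|` [set r | X r \notin A] `|` [set r | Y r \notin B]).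
  have XA0 := has_law_null _ _ _ _ _ _ _ _ lawX P0.
  have YB0 := has_law_null _ _ _ _ _ _ _ _ lawY Q0.
  by rewrite !measureU0 //; exact: measurableU.
apply: le_measure; rewrite ?inE.
- exact: measurableC.
- by apply: measurableU => //; exact: measurableU.
move=> r /= /negP; rewrite !negb_and => /or3P[/eqP|?|?]; by [left; left|left; right|right].
Qed.

(** * Choice of the parameters *)

(** With [c = 1 - delta] and [K] the integer part of [c * n], the ratio [K.+1 / n] lies just above
    [c] and [(N - K) / N] is at most [delta + 1 / n]. The limit value is [c ^ 2 / (1 - delta ^ 2) =
    c / (1 + delta)]. *)
Lemma exists_draw_parameters (R : realType) (delta gamma : R) :
  0 < delta -> delta < 1 -> 0 < gamma ->
  exists N K : nat, [/\ (0 < K)%N, (K <= N)%N,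
    1 - K.+1%:R / N.+1%:R <= delta &
    (K.+1%:R / N.+1%:R) ^+ 2 / (1 - ((N - K)%:R / N%:R) ^+ 2)
      <= (1 - delta) / (1 + delta) + gamma].
Proof.
move=> delta_gt0 delta_lt1 gamma_gt0.
pose c := 1 - delta.
have c_gt0 : 0 < c by rewrite subr_gt0.
have cg_gt0 : 0 < c * gamma by rewrite mulr_gt0.
(* With [e = 1 / n], the proof ends with [(c + e) ^ 2 <= (c - e) * (c + gamma * (1 + delta))]. Since
   [e ^ 2 <= e * c] and [e < c], this follows from [e * (4 * c + gamma) <= c * gamma]. *)
pose n := Num.bound ((4 * c + gamma) / (c * gamma)).
have n_gt : 4 * c + gamma < n%:R * (c * gamma).
  rewrite -ltr_pdivrMr // /n archi_boundP // divr_ge0 //; lra.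
move: n n_gt => n n_gt.
have n_gt0 : 0 < n%:R :> R.
  by rewrite -(pmulr_lgt0 _ cg_gt0); apply: lt_trans n_gt; lra.
have cn_gt1 : 1 < c * n%:R.
  by rewrite -(ltr_pM2r gamma_gt0); lra.
pose K := Num.truncn (c * n%:R).
have /andP[le_K lt_K] : K%:R <= c * n%:R < K.+1%:R.
  by apply: truncn_itv; rewrite mulr_ge0 // ltW.
move: K le_K lt_K => K le_K lt_K.
have K_gt0 : (0 < K)%N.
  by rewrite -ltnS -(ltr_nat R); exact: lt_trans lt_K.
have lt_Kn : (K < n)%N.
  rewrite -(ltr_nat R); apply: le_lt_trans le_K _.
  by rewrite gtr_pMl // /c; lra.
have nE : n = n.-1.+1 by rewrite prednK //; lia.
exists n.-1, K; rewrite -nE; split=> //; first by lia.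
  rewrite lerBlDr addrC -lerBlDr ler_pdivlMr //; exact: ltW.
set N := n.-1.
have le_KN : (K <= N)%N by rewrite /N; lia.
have N_gt0 : 0 < N%:R :> R by rewrite ltr0n /N; lia.
have NE : n%:R = N%:R + 1 :> R by rewrite nE natr1.
pose e : R := n%:R^-1.
have e_gt0 : 0 < e by rewrite invr_gt0.
have en : e * n%:R = 1 by rewrite mulVf // lt0r_neq0.
have e_small : e * (4 * c + gamma) < c * gamma.
  by rewrite -(ltr_pM2l n_gt0) mulrA (mulrC n%:R e) en mul1r.
have e_ltc : e < c by rewrite -(ltr_pM2r n_gt0) en.
set p := K.+1%:R / n%:R.
have p_ge0 : 0 <= p by rewrite divr_ge0.
have p_le : p <= c + e.
  by rewrite ler_pdivrMr // mulrDl en -natr1 lerD2r.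
set q := (N - K)%:R / N%:R.
have q_ge0 : 0 <= q by rewrite divr_ge0.
have qE : q * N%:R = N%:R - K%:R.
  by rewrite divfK ?lt0r_neq0 // natrB.
(* Here [N - K < delta * n = delta * N + delta], and [delta < 1 - e = e * N]. *)
have q_le : q <= delta + e.
  rewrite -(ler_pM2r N_gt0) qE.
  move: lt_K en e_ltc; rewrite -natr1 NE /c !mulrDr !mulr1 => lt_K en e_ltc.
  rewrite mulrDl; clear - lt_K en e_ltc; lra.
have q2_le : q ^+ 2 <= (delta + e) ^+ 2 by rewrite ler_pXn2r // nnegrE; lra.
have p2_le : p ^+ 2 <= (c + e) ^+ 2 by rewrite ler_pXn2r // nnegrE; lra.
(* [1 - (delta + e) ^ 2] factors as [(c - e) * (1 + delta + e)]. *)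
have q2_lt1 : (c - e) * (1 + delta) <= 1 - q ^+ 2.
  have : 0 <= (c - e) * e by rewrite mulr_ge0 // ltW // subr_gt0.
  by move: q2_le; rewrite /c; lra.
have D_gt0 : 0 < (c - e) * (1 + delta) by rewrite mulr_gt0 // ?subr_gt0 //; lra.
rewrite ler_pdivrMr; last exact: lt_le_trans q2_lt1.
have b_ge0 : 0 <= c / (1 + delta) + gamma.
  by rewrite addr_ge0 // ?divr_ge0 // ltW //; lra.
apply: le_trans (ler_wpM2l b_ge0 q2_lt1).
have -> : (c / (1 + delta) + gamma) * ((c - e) * (1 + delta)) =
    (c - e) * (c + gamma * (1 + delta)).
  by field; lra.
apply: (le_trans p2_le).
have : 0 <= (c - e) * (gamma * delta).
  by rewrite !mulr_ge0 // ltW // subr_gt0.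
have : e * e <= e * c by rewrite ler_pM2l // ltW.
lra.
Qed.

Theorem theorem1p3 (R : realType) (delta gamma : R)
    (delta_gt0 : 0 < delta) (delta_lt1 : delta < 1) (gamma_gt0 : 0 < gamma) :
  exists (Omega : finType) (F : set (fdist R Omega * fdist R Omega)),
    (forall P Q : fdist R Omega, F (P, Q) -> dTV P Q <= delta) /\
    (forall (d : measure_display) (T : measurableType d)
        (Pr : probability T R) (f g : fdist R Omega -> T -> Omega),
      correlated_sampling_strategy Pr f g ->
      exists P Q : fdist R Omega, F (P, Q) /\
        ((2 * delta / (1 + delta) - gamma)%:E <= disagreement Pr f g P Q)%E).
Proof.
have [N [K [K_gt0 le_KN dTV_le theta_le]]] :=
  exists_draw_parameters R delta gamma delta_gt0 delta_lt1 gamma_gt0.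
pose I := ('I_N.+1 * 'I_N.+1)%type.
pose J := {S : {set 'I_N.+1} | #|S| == K.+1}.
pose A (S : J) : {set I} := fst @^-1: val S.
pose B (S : J) : {set I} := snd @^-1: val S.
have cardS (S : J) : #|val S| = K.+1 by exact/eqP/(valP S).
have cardA S : #|A S| = (K.+1 * N.+1)%N.
  have -> : A S = finset.setX (val S) [set: 'I_N.+1]%SET.
    by apply/setP => x; rewrite !inE andbT.
  by rewrite cardsX cardS cardsT card_ord.
have cardB S : #|B S| = (K.+1 * N.+1)%N.
  have -> : B S = finset.setX [set: 'I_N.+1]%SET (val S).
    by apply/setP => x; rewrite !inE.
  by rewrite cardsX cardS cardsT card_ord mulnC.
have cardAB S S' : #|A S :&: B S'| = (K.+1 * K.+1)%N.
  have -> : A S :&: B S' = finset.setX (val S) (val S').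
    by apply/setP => x; rewrite !inE.
  by rewrite cardsX !cardS.
have A_gt0 S : (0 < #|A S|)%N by rewrite cardA.
have B_gt0 S : (0 < #|B S|)%N by rewrite cardB.
pose P S := uniform_fdist R I (A S) (A_gt0 S).
pose Q S := uniform_fdist R I (B S) (B_gt0 S).
exists I, [set PQ | exists S S', PQ = (P S, Q S')]; split.
  move=> _ _ [S [S' [-> ->]]]; rewrite dTV_uniform ?cardA ?cardB // cardAB.
  by rewrite !natrM -mulf_div divff ?pnatr_eq0 // mul1r.
move=> d T Pr f g [f_law g_law].
(* The bound on agreement: [1 - theta] is the required disagreement. *)
pose theta := (1 - delta) / (1 + delta) + gamma.
pose E (p : J * J) := [set r | [&& f (P p.1) r == g (Q p.2) r,
  f (P p.1) r \in A p.1 & g (Q p.2) r \in B p.2]].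
have cardJ : #|{: J}| = 'C(N.+1, K.+1).
  by rewrite card_draws_sig card_ord.
have J_gt0 : (0 < #|{: J}|)%N by rewrite cardJ bin_gt0.
have [||r|[S S'] PrE] := exists_probability_le R d T Pr (J * J)%type E theta.
- by rewrite card_prod muln_gt0 J_gt0.
- move=> p.
  exact: (measurable_finite_rel I _ _ _ _
    (fun v w => [&& v == w, v \in A p.1 & w \in B p.2]) (f_law _).1 (g_law _).1).
- have -> : \sum_p \1_(E p) r = #|[set p : J * J | [&& f (P p.1) r == g (Q p.2) r,
      f (P p.1) r \in A p.1 & g (Q p.2) r \in B p.2]]%SET|%:R :> R.
    rewrite -sum1_card natr_sum [RHS]big_mkcond /=; apply: eq_bigr => p _.
    rewrite indicE inE; case: ifPn => Ep; first by rewrite mem_set.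
    by rewrite memNset //; exact/negP.
  pose q : R := (N - K)%:R / N%:R.
  have N_gt0 : 0 < N%:R :> R by rewrite ltr0n (leq_trans K_gt0).
  have q_ge0 : 0 <= q by rewrite divr_ge0.
  have q_lt1 : q < 1.
    by rewrite ltr_pdivrMr // mul1r ltr_nat ltn_subrL K_gt0 (leq_trans K_gt0).
  (* For fixed [r], the value [f (P S) r] depends on [S] alone and [g (Q S') r] on [S'] alone, as
     the count of agreeing pairs requires. *)
  apply: le_trans.
    apply: (card_agreement_le R J I A B (fun S => f (P S) r) (fun S => g (Q S) r)
      (fun i => 'C(N, K)%:R * q ^+ i)).
    + by move=> i; rewrite mulr_ge0 // exprn_ge0.
    + by move=> i; rewrite ler_wpM2l // exprS ler_piMl ?exprn_ge0 // ltW.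
    + by move=> X; exact: card_draws_hit_le.
    + by move=> X; exact: card_draws_hit_le.
  apply: (le_trans (sum_sqr_geometric_le _ _ _ _ q_ge0 q_lt1)).
  (* Dividing by [#|J|] turns the leading coefficient of the geometric majorant into [K.+1 / N.+1],
     the chance that a given row is drawn. *)
  have -> : 'C(N, K)%:R = K.+1%:R / N.+1%:R * 'C(N.+1, K.+1)%:R :> R.
    apply: (@mulfI _ N.+1%:R); first by rewrite pnatr_eq0.
    rewrite -natrM mul_bin_diag natrM mulrA; congr (_ * _).
    by rewrite mulrC divfK // pnatr_eq0.
  by rewrite card_prod cardJ natrM -expr2 exprMn mulrAC ler_wpM2r // sqr_ge0.
exists (P S), (Q S'); split; first by exists S, S'.
have supp (D : {set I}) D_gt0 w : w \notin D -> uniform_fdist R I D D_gt0 w = 0.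
  by rewrite /= ffunE => /negbTE ->; rewrite mul0r.
apply: le_trans (disagreement_ge_supports _ _ _ _ _ _ _ _ _ _ _ (f_law (P S))
  (g_law (Q S')) (supp _ _) (supp _ _)).
have -> : 2 * delta / (1 + delta) - gamma = 1 - theta by rewrite /theta; field; lra.
by rewrite EFinB leeB.
Qed.
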